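(* Let $\mathcal{A}$ be a unital $*$-algebra with unit $I$ and let $\mathcal{M}$ be a unital $*$-$\mathcal{A}$-bimodule with the property $\mathbb{M}$. If $\delta$ and $\tau$ are linear mappings from $\mathcal{A}$ into $\mathcal{M}$ satisfying $$A,B\in\mathcal{A},\ A\circ B^*=0 \quad\Longrightarrow\quad \delta(A)\circ B^*+A\circ\tau(B)^*=0,$$ then there exist Jordan derivations $\Delta$ and $\Gamma$ from $\mathcal{A}$ into $\mathcal{M}$ such that $\delta(A)=\Delta(A)+\delta(I)A$, $\tau(A)=\Gamma(A)+\tau(I)A$, and $\Delta(A^* )=\Gamma(A)^*$ for every $A\in\mathcal{A}$.
   Context: Algebras are over the real or complex field. $X\circ Y=XY+YX$ denotes the Jordan product (also when one of the factors lies in a bimodule). A $*$-$\mathcal{A}$-bimodule over a $*$-algebra $\mathcal{A}$ is an $\mathcal{A}$-bimodule $\mathcal{M}$ with a conjugate-linear map $M\mapsto M^*$ satisfying $M^{**}=M$, $(AM)^*=M^*A^*$, $(MA)^*=A^*M^*$ for $A\in\mathcal{A}$, $M\in\mathcal{M}$; it is unital if $IM=MI=M$. $\tau(B)^*$ means $(\tau(B))^*$. A linear mapping $\Delta:\mathcal{A}\to\mathcal{M}$ is a Jordan derivation if $\Delta(A^2)=\Delta(A)A+A\Delta(A)$ for each $A\in\mathcal{A}$. Let $\mathfrak{F}(\mathcal{A})$ denote the subalgebra of $\mathcal{A}$ generated by all idempotents in $\mathcal{A}$. An $\mathcal{A}$-bimodule $\mathcal{M}$ has the property $\mathbb{M}$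 if there is an ideal $\mathcal{J}$ of $\mathcal{A}$ with $\mathcal{J}\subseteq\mathfrak{F}(\mathcal{A})$ such that $\{M\in\mathcal{M}: XMX=0 \text{ for every } X\in\mathcal{J}\}=\{0\}$. *)

(* Defs.v *)
From HB Require Import structures.
From mathcomp Require Import all_boot all_order all_algebra.
From mathcomp Require Import boolp classical_sets reals.
From mathcomp Require Import complex.

Set Implicit Arguments.
Unset Strict Implicit.
Unset Printing Implicit Defensive.

Import GRing.Theory.
Local Open Scope classical_set_scope.
Local Open Scope ring_scope.

(* Scalar field together with the conjugation entering "conjugate-linear":
   either the reals with the identity or the complex numbers with complex
   conjugation. *)
Variant real_or_complex (R : realType) :
    forall F : fieldType, (F -> F) -> Prop :=
  | RealScalars : @real_or_complex R R idfun
  | ComplexScalars : @real_or_complex R R[i] (@conjc R).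

HB.mixin Record isStarAlgebra (F : fieldType) (conj : F -> F) (A : Type)
    of GRing.Algebra F A := {
  star : A -> A;
  starK : involutive star;
  starD : {morph star : x y / x + y};
  starZ : forall (k : F) (x : A), star (k *: x) = conj k *: star x;
  starM : forall x y : A, star (x * y) = star y * star x
}.

#[short(type="starAlgType")]
HB.structure Definition StarAlgebra (F : fieldType) (conj : F -> F) :=
  {A of isStarAlgebra F conj A & GRing.Algebra F A}.

(* The unit of the algebra is not required to act as the identity here;
   see [unital_bimodule]. *)
HB.mixin Record isBimodule (F : fieldType) (A : algType F) (M : Type)
    of GRing.Lmodule F M := {
  lact : A -> M -> M;
  ract : M -> A -> M;
  lactDl : forall a b m, lact (a + b) m = lact a m + lact b m;
  lactDr : forall a m n, lact a (m + n) = lact a m + lact a n;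
  lactZl : forall (k : F) a m, lact (k *: a) m = k *: lact a m;
  lactZr : forall (k : F) a m, lact a (k *: m) = k *: lact a m;
  ractDl : forall m n a, ract (m + n) a = ract m a + ract n a;
  ractDr : forall m a b, ract m (a + b) = ract m a + ract m b;
  ractZl : forall (k : F) m a, ract (k *: m) a = k *: ract m a;
  ractZr : forall (k : F) m a, ract m (k *: a) = k *: ract m a;
  lactM : forall a b m, lact (a * b) m = lact a (lact b m);
  ractM : forall m a b, ract m (a * b) = ract (ract m a) b;
  lract : forall a m b, ract (lact a m) b = lact a (ract m b)
}.

#[short(type="bimodType")]
HB.structure Definition Bimodule (F : fieldType) (A : algType F) :=
  {M of isBimodule F A M & GRing.Lmodule F M}.

HB.mixin Record isStarBimodule (F : fieldType) (conj : F -> F)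
    (A : starAlgType conj) (M : Type) of Bimodule F A M := {
  mstar : M -> M;
  mstarK : involutive mstar;
  mstarD : {morph mstar : m n / m + n};
  mstarZ : forall (k : F) (m : M), mstar (k *: m) = conj k *: mstar m;
  mstar_lact : forall (a : A) (m : M), mstar (lact a m) = ract (mstar m) (star a);
  mstar_ract : forall (a : A) (m : M), mstar (ract m a) = lact (star a) (mstar m)
}.

#[short(type="starBimodType")]
HB.structure Definition StarBimodule (F : fieldType) (conj : F -> F)
    (A : starAlgType conj) :=
  {M of isStarBimodule F conj A M & Bimodule F A M}.

Declare Scope bimod_scope.
Delimit Scope bimod_scope with bimod.
Notation "a *:> m" := (lact a m) (at level 40, left associativity) : bimod_scope.
Notation "m <:* a" := (ract m a) (at level 40, left associativity) : bimod_scope.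
Local Open Scope bimod_scope.

Section Notions.
Variables (F : fieldType) (A : algType F).

Definition jordan_prod (x y : A) : A := x * y + y * x.

Definition idempotent_subalgebra : set A :=
  smallest [set S : set A | GRing.subalg_closed [in S]] [set e | e * e = e].

Definition two_sided_ideal (J : set A) : Prop :=
  GRing.submod_closed [in J] /\
  forall a x, J x -> J (a * x) /\ J (x * a).

Variable M : bimodType A.

Definition unital_bimodule : Prop :=
  forall m : M, (1 : A) *:> m = m /\ m <:* (1 : A) = m.

Definition jordan_lprod (a : A) (m : M) : M := a *:> m + m <:* a.
Definition jordan_rprod (m : M) (a : A) : M := m <:* a + a *:> m.

Definition jordan_derivation (D : {linear A -> M}) : Prop :=
  forall a : A, D (a * a) = D a <:* a + a *:> D a.

Definition property_M : Prop :=
  exists J : set A, [/\ two_sided_ideal J, J `<=` idempotent_subalgebra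
    & [set m : M | forall x, J x -> x *:> m <:* x = 0] = [set 0]].

End Notions.

Arguments unital_bimodule {F A} M.
Arguments property_M {F A} M.

(* Main.v *)
Require Import Defs.
From HB Require Import structures.
From mathcomp Require Import all_boot all_order all_algebra.
From mathcomp Require Import boolp classical_sets reals complex.
From Stdlib Require Ncring Ncring_tac.

Set Implicit Arguments.
Unset Strict Implicit.
Unset Printing Implicit Defensive.

Import GRing.Theory.
Local Open Scope ring_scope.
Local Open Scope bimod_scope.

(** Put [sigma b = (tau b^* )^*]; it is linear, and the hypothesis says that the
    bilinear map [phi a b = delta a o b + a o sigma b] vanishes whenever
    [a o b = 0], where [o] is the Jordan product.  Let [FA] be the subalgebra
    generated by the idempotents and [J] the ideal given by property M.

    A bilinear map that vanishes on such pairs satisfies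
    [2 phi a x = phi (a o x) 1] for all [a] and all [x] in [FA]
    ([jzp_idemsub_r]).  After subtracting a multiple of [phi (a o b) 1] one has
    [phi a 1 = 0], and has to show [phi a x = 0].  For an idempotent [x] this
    follows from the Peirce decomposition of [a], each Peirce component being in
    an explicit Jordan-zero pair.  The step to products of idempotents rests on
    [phi a (e z) = phi (e a e) z]: the set of [z] with [phi _ z = 0] is stable
    under left multiplication by idempotents, hence under [FA].

    Write [c = delta 1] and [d = sigma 1].  These identities for [delta] and
    [sigma] show that [c + d] commutes with [FA], hence with [A] since [J]
    detects zero ([sum_comm]), and that [c - d] commutes with every commutator
    [x a - a x] with [x] in [FA] ([diff_comm]).  It follows that
    [delta a - c a = sigma a - a d] ([delta_sub_sigma]) and that
    [Delta a = delta a - c a] satisfies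
    [Delta (a o x) = Delta a o x + a o Delta x] for [x] in [FA].

    It remains to remove the restriction on [x]
    ([jordan_derivation_from_idemsub]).  The defect
    [w a b = Delta (a o b) - Delta a o b - a o Delta b] satisfies
    [w a b x = w (x a) b] for [x] in [FA].  For an idempotent [x = e] one may
    subtract an inner derivation, which changes no defect, to get
    [Delta e = 0]; then [Delta] respects the Peirce decomposition and the
    identity is read off from the corners.  For [x] in [J] the product [x a]
    lies in [J], hence in [FA], so that [w a a x = w (x a) a = 0], and [J]
    detects that [w a a = 0].

    Finally [Gamma a = (Delta a^* )^*], and applying [*] to
    [Delta a = sigma a - a d] yields [Gamma a = tau a - tau 1 a]. *)

(** * Computing in noncommutative rings and bimodules *)

Section NoncommutativeRing.
Variable R : pzRingType.

#[global] Instance pzRing_ops :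
  @Ncring.Ring_ops R 0 1 +%R *%R (fun x y => x - y) -%R eq := {}.

#[global] Instance pzRing_ring : Ncring.Ring (Ro := pzRing_ops).
Proof.
constructor; try exact _.
- exact: add0r.
- exact: addrC.
- exact: addrA.
- exact: mul1r.
- exact: mulr1.
- exact: mulrA.
- exact: mulrDl.
- by move=> x y z; exact: mulrDr.
- by [].
- exact: subrr.
Qed.

End NoncommutativeRing.

(** The ring [A * M], in which [M] squares to zero, contains [A] and [M] and
    turns both actions into its multiplication, so that bimodule identities
    become identities of a noncommutative ring. *)
Section TrivialExtension.
Variables (F : fieldType) (A : algType F) (M : bimodType A).
Hypothesis hunit : unital_bimodule M.

Lemma lact0 (a : A) : a *:> (0 : M) = 0.
Proof. by apply: (addrI (a *:> 0)); rewrite -lactDr !addr0. Qed.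

Lemma ract0 (a : A) : (0 : M) <:* a = 0.
Proof. by apply: (addrI (0 <:* a)); rewrite -ractDl !addr0. Qed.

(** Indexing by the proof of unitality keeps the ring structure declared below
    apart from the componentwise one on the product [A * M]. *)
Definition trivial_extension of unital_bimodule M := (A * M)%type.
Local Notation B := (trivial_extension hunit).

HB.instance Definition _ := GRing.Zmodule.on B.

Definition te_mul (x y : B) : B := (x.1 * y.1, x.1 *:> y.2 + x.2 <:* y.1).

Definition te_one : B := (1, 0).

Fact te_mulA : associative te_mul.
Proof.
move=> x y z; rewrite /te_mul /= mulrA; congr pair.
by rewrite lactDr ractDl lactM ractM lract addrA.
Qed.

Fact te_mul1 : left_id te_one te_mul.
Proof.
case=> a m; rewrite /te_mul /= mul1r ract0 addr0; congr pair.
by case: (hunit m).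
Qed.

Fact te_mulr1 : right_id te_one te_mul.
Proof.
case=> a m; rewrite /te_mul /= mulr1 lact0 add0r; congr pair.
by case: (hunit m).
Qed.

Fact te_mulDl : left_distributive te_mul +%R.
Proof.
case=> [a m] [b n] [c p]; rewrite /te_mul /= mulrDl lactDl ractDl.
by congr pair; rewrite addrACA.
Qed.

Fact te_mulDr : right_distributive te_mul +%R.
Proof.
case=> [a m] [b n] [c p]; rewrite /te_mul /= mulrDr lactDr ractDr.
by congr pair; rewrite addrACA.
Qed.

HB.instance Definition _ := GRing.Zmodule_isPzRing.Build B
  te_mulA te_mul1 te_mulr1 te_mulDl te_mulDr.

Definition inA (a : A) : B := (a, 0).
Definition inM (m : M) : B := (0, m).

Lemma inM_inj : injective inM.
Proof. by move=> m n []. Qed.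

Lemma inA0 : inA 0 = 0. Proof. by []. Qed.
Lemma inA1 : inA 1 = 1. Proof. by []. Qed.
Lemma inAD a b : inA (a + b) = inA a + inA b.
Proof. by congr pair; rewrite addr0. Qed.
Lemma inAN a : inA (- a) = - inA a.
Proof. by congr pair; rewrite oppr0. Qed.
Lemma inAM a b : inA (a * b) = inA a * inA b.
Proof. by congr pair; rewrite lact0 ract0 addr0. Qed.
Lemma inM0 : inM 0 = 0. Proof. by []. Qed.
Lemma inMD m n : inM (m + n) = inM m + inM n.
Proof. by congr pair; rewrite addr0. Qed.
Lemma inMN m : inM (- m) = - inM m.
Proof. by congr pair; rewrite oppr0. Qed.
Lemma inM_lact a m : inM (a *:> m) = inA a * inM m.
Proof. by congr pair; rewrite ?mulr0 // ract0 addr0. Qed.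
Lemma inM_ract m a : inM (m <:* a) = inM m * inA a.
Proof. by congr pair; rewrite ?mul0r // lact0 add0r. Qed.

Definition embE := (inA0, inA1, inAD, inAN, inAM, inM0, inMD, inMN,
  inM_lact, inM_ract).

End TrivialExtension.

(** For proving [x = y] from an equation [p = q] assembled out of known ones:
    the remaining goal is an identity of the bimodule. *)
Lemma eq_from_eq (V : zmodType) (x y p q : V) : p = q -> x - y = p - q -> x = y.
Proof. by move=> ->; rewrite subrr => /subr0_eq. Qed.

Lemma mulr_idem (R : pzRingType) (e : R) : e * e = e ->
  forall x, x * e * e = x * e.
Proof. by move=> he x; rewrite -mulrA he. Qed.

Ltac ncring :=
  rewrite /jordan_prod; Ncring_tac.non_commutative_ring.

(** Products are expanded before [e * e] is replaced by [e] in them; the expanded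
    words are left associated, whence the second rule [mulr_idem]. *)
Ltac idem_ring he :=
  rewrite /jordan_prod ?mulr1 ?mul1r;
  rewrite ?(mulrDl, mulrDr, mulrN, mulNr, mulr1, mul1r, mulrA, he);
  rewrite ?(mulr_idem he, he);
  Ncring_tac.non_commutative_ring.

(** The unitality hypothesis, an index of the trivial extension, is found in the
    context of the goal. *)
Ltac to_trivial_extension :=
  rewrite /jordan_prod /jordan_lprod /jordan_rprod;
  match goal with h : unital_bimodule _ |- _ = _ =>
    apply: (@inM_inj _ _ _ h); rewrite ?embE end.

Ltac bimod := to_trivial_extension; Ncring_tac.non_commutative_ring.

Ltac idem_bimod he :=
  to_trivial_extension;
  match goal with h : unital_bimodule _ |- _ =>
  let H := fresh in have H := congr1 (inA h) he;
  rewrite inAM in H;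
  rewrite ?(mulrDl, mulrDr, mulrN, mulNr, mulr1, mul1r, mulrA, H, mulr_idem H)
  end;
  Ncring_tac.non_commutative_ring.

Lemma linear_add (F : fieldType) (U V : lmodType F) (f g : U -> V) :
  linear f -> linear g -> linear (fun x => f x + g x).
Proof. by move=> hf hg k x y; rewrite hf hg addrACA scalerDr. Qed.

Lemma linear_sub (F : fieldType) (U V : lmodType F) (f g : U -> V) :
  linear f -> linear g -> linear (fun x => f x - g x).
Proof. by move=> hf hg k x y; rewrite hf hg opprD addrACA scalerBr. Qed.

Lemma linear_jordan_prodl (F : fieldType) (A : algType F) (b : A) :
  linear (fun a => jordan_prod a b).
Proof.
move=> k x y; rewrite /jordan_prod mulrDl mulrDr -scalerAl -scalerAr addrACA.
by rewrite scalerDr.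
Qed.

Lemma linear_jordan_prodr (F : fieldType) (A : algType F) (a : A) :
  linear (jordan_prod a).
Proof.
move=> k x y; rewrite /jordan_prod mulrDl mulrDr -scalerAl -scalerAr addrACA.
by rewrite scalerDr.
Qed.

Lemma eq_add (V : zmodType) (x y z t : V) : x = y -> z = t -> x + z = y + t.
Proof. by move=> -> ->. Qed.

Lemma eq_sub (V : zmodType) (x y z t : V) : x = y -> z = t -> x - z = y - t.
Proof. by move=> -> ->. Qed.

Lemma addrr_eq0 (F : fieldType) (V : lmodType F) (m : V) :
  (2%:R : F) != 0 -> m + m = 0 -> m = 0.
Proof.
move=> h2 /eqP; rewrite -mulr2n -scaler_nat scaler_eq0 (negbTE h2) /=.
by move/eqP.
Qed.

Lemma addrr_inj (F : fieldType) (V : lmodType F) (m n : V) :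
  (2%:R : F) != 0 -> m + m = n + n -> m = n.
Proof.
move=> h2 h; apply/subr0_eq/(addrr_eq0 h2).
by rewrite addrACA -opprD h subrr.
Qed.

(** * The subalgebra generated by the idempotents *)

Section IdempotentSubalgebra.
Variables (F : fieldType) (A : algType F).
Local Notation FA := (@idempotent_subalgebra F A).

Lemma idempotent_subalgebra_ind (P : A -> Prop) :
  P 1 -> (forall k x y, P x -> P y -> P (k *: x + y)) ->
  (forall x y, P x -> P y -> P (x * y)) -> (forall e, e * e = e -> P e) ->
  forall x, FA x -> P x.
Proof.
move=> P1 Plin Pmul Pid; apply: smallest_sub => //; split.
- by rewrite inE.
- by move=> k x y; rewrite !inE; apply: Plin.
- by move=> x y; rewrite !inE; apply: Pmul.
Qed.

Lemma idemsub_idem e : e * e = e -> FA e.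
Proof. by move=> he; apply: sub_gen_smallest. Qed.

Lemma idemsub_lin k x y : FA x -> FA y -> FA (k *: x + y).
Proof.
move=> hx hy S [[S1 Sl Sm] hS].
by apply/set_mem/Sl; apply/mem_set; [apply: hx | apply: hy].
Qed.

Lemma idemsub1 : FA 1.
Proof. by apply: idemsub_idem; rewrite mulr1. Qed.

Lemma idemsubD x y : FA x -> FA y -> FA (x + y).
Proof. by move=> hx hy; rewrite -[x]scale1r; apply: idemsub_lin. Qed.

Lemma idemsubB x y : FA x -> FA y -> FA (x - y).
Proof. by move=> hx hy; rewrite addrC -scaleN1r; apply: idemsub_lin. Qed.

Lemma idem_compl (e : A) : e * e = e -> (1 - e) * (1 - e) = 1 - e.
Proof. by move=> he; idem_ring he. Qed.

Lemma idem_shift_ur (e a : A) : e * e = e ->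
  (e + e * a * (1 - e)) * (e + e * a * (1 - e)) = e + e * a * (1 - e).
Proof. by move=> he; idem_ring he. Qed.

Lemma idem_shift_dl (e a : A) : e * e = e ->
  (e + (1 - e) * a * e) * (e + (1 - e) * a * e) = e + (1 - e) * a * e.
Proof. by move=> he; idem_ring he. Qed.

(** Off-diagonal Peirce components are differences of two idempotents. *)
Lemma idemsub_offdiag_ur (e a : A) : e * e = e -> FA (e * a * (1 - e)).
Proof.
move=> he; rewrite -[X in FA X](addKr e) addrC.
apply: idemsubB; apply: idemsub_idem => //.
exact: idem_shift_ur.
Qed.

Lemma idemsub_offdiag_dl (e a : A) : e * e = e -> FA ((1 - e) * a * e).
Proof.
move=> he; rewrite -[X in FA X](addKr e) addrC.
apply: idemsubB; apply: idemsub_idem => //.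
exact: idem_shift_dl.
Qed.

End IdempotentSubalgebra.

(** * Bilinear maps vanishing on Jordan-zero pairs *)

Section JordanZeroProducts.
Variables (F : fieldType) (A : algType F) (X : lmodType F).
Hypothesis two_neq0 : (2%:R : F) != 0.
Implicit Types (phi : A -> A -> X) (a b x e : A).

Record jordan_zero_preserving phi : Prop := {
  jzp_linl : forall b, linear (phi^~ b);
  jzp_linr : forall a, linear (phi a);
  jzp_zero : forall a b, jordan_prod a b = 0 -> phi a b = 0 }.

Section Arithmetic.
Variable phi : A -> A -> X.
Hypothesis hphi : jordan_zero_preserving phi.

Lemma jzpDl a b x : phi (a + b) x = phi a x + phi b x.
Proof. by have := jzp_linl hphi x 1 a b; rewrite !scale1r. Qed.

Lemma jzpDr a x y : phi a (x + y) = phi a x + phi a y.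
Proof. by have := jzp_linr hphi a 1 x y; rewrite !scale1r. Qed.

Lemma jzp0l x : phi 0 x = 0.
Proof. by apply: (addrI (phi 0 x)); rewrite -jzpDl !addr0. Qed.

Lemma jzp0r a : phi a 0 = 0.
Proof. by apply: (addrI (phi a 0)); rewrite -jzpDr !addr0. Qed.

Lemma jzpNr a x : phi a (- x) = - phi a x.
Proof. by apply: (addrI (phi a x)); rewrite -jzpDr !subrr jzp0r. Qed.

End Arithmetic.

(** The diagonal Peirce components of [a] pair to zero with [e] or [1 - e], and an
    off-diagonal [u] has [u o (2 e - 1) = 0]. *)
Lemma jzp_idem phi (hphi : jordan_zero_preserving phi)
    (h1 : forall a, phi a 1 = 0) e (he : e * e = e) a : phi a e = 0.
Proof.
have -> : a = e * a * e + (1 - e) * a * (1 - e)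
              + (e * a * (1 - e) + (1 - e) * a * e) by ncring.
set u := e * a * (1 - e) + (1 - e) * a * e.
have h11 : phi (e * a * e) e = 0.
  have : phi (e * a * e) (1 - e) = 0 by apply: (jzp_zero hphi); idem_ring he.
  rewrite (jzpDr hphi) (jzpNr hphi) h1 add0r => /eqP.
  by rewrite oppr_eq0 => /eqP.
have h22 : phi ((1 - e) * a * (1 - e)) e = 0.
  by apply: (jzp_zero hphi); idem_ring he.
have hu : phi u e = 0.
  apply: (addrr_eq0 two_neq0); rewrite -(jzpDr hphi).
  have : phi u (e + e - 1) = 0.
    by apply: (jzp_zero hphi); rewrite /u; idem_ring he.
  by rewrite (jzpDr hphi) (jzpNr hphi) h1 subr0.
by clearbody u; rewrite !(jzpDl hphi) h11 h22 hu !addr0.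
Qed.

(** Still vanishing on Jordan-zero pairs, and zero when the second argument is
    [1]. *)
Definition normalize phi a b : X := phi a b + phi a b - phi (jordan_prod a b) 1.

Lemma normalize_jzp phi :
  jordan_zero_preserving phi -> jordan_zero_preserving (normalize phi).
Proof.
move=> hphi; split; rewrite /normalize.
- move=> b k x y /=; rewrite linear_jordan_prodl !(jzp_linl hphi).
  rewrite [X in X - _]addrACA opprD [LHS]addrACA.
  by rewrite -scalerDr -scalerN -scalerDr.
- move=> a k x y; rewrite linear_jordan_prodr (jzp_linl hphi) (jzp_linr hphi).
  rewrite [X in X - _]addrACA opprD [LHS]addrACA.
  by rewrite -scalerDr -scalerN -scalerDr.
- by move=> a b h0; rewrite (jzp_zero hphi h0) h0 (jzp0l hphi) addr0 subr0.
Qed.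

Lemma normalize1 phi (hphi : jordan_zero_preserving phi) a :
  normalize phi a 1 = 0.
Proof. by rewrite /normalize /jordan_prod mulr1 mul1r (jzpDl hphi) subrr. Qed.

Lemma jzp_swap phi :
  jordan_zero_preserving phi -> jordan_zero_preserving (fun a b => phi b a).
Proof.
move=> hphi; split=> [b | a | a b h0]; [exact: jzp_linr | exact: jzp_linl |].
by apply: (jzp_zero hphi); rewrite /jordan_prod addrC.
Qed.

(** The key is [corner]: the off-diagonal components of [e z], of [z] and of [a]
    contribute nothing, so [phi a (e z) = phi (e a e) (e z e) = phi (e a e) z]
    and vanishing of [phi _ z] is inherited by [phi _ (e z)].  Off-diagonal [a]
    is the delicate case: there [phi a y] is rewritten through the mirror
    identity [idl], which concerns idempotents on the left. *)
Lemma normalized_jzp phi (hphi : jordan_zero_preserving phi)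
    (h1 : forall a, phi a 1 = 0) x :
  idempotent_subalgebra x -> forall a, phi a x = 0.
Proof.
have idl e (he : e * e = e) a : phi e a + phi e a = phi 1 (jordan_prod e a).
  have hs := jzp_swap hphi.
  have := jzp_idem (normalize_jzp hs) (normalize1 hs) he a.
  by rewrite /normalize => /subr0_eq ->; rewrite /jordan_prod addrC.
have one_off e u : e * e = e -> (e + u) * (e + u) = e + u -> phi 1 u = 0.
  move=> he hf; rewrite -[u](addKr e) addrC (jzpDr hphi) (jzpNr hphi).
  by rewrite !(jzp_idem hphi h1) // subr0.
(* For [u] off-diagonal and [y] in the corner of [e], the defect of [phi u y]
   is [phi 1] of an off-diagonal element. *)
have off_corner e u y : e * e = e -> (e + u) * (e + u) = e + u ->
    (e + jordan_prod u y) * (e + jordan_prod u y) = e + jordan_prod u y ->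
    phi u y = 0.
  move=> he hu huy; apply: (addrr_eq0 two_neq0); rewrite -(one_off _ _ he huy).
  have -> : phi u y = phi (e + u) y - phi e y.
    by rewrite (jzpDl hphi) addrC addKr.
  rewrite addrACA -opprD !idl // -(jzpNr hphi) -(jzpDr hphi).
  by congr (phi 1 _); ncring.
have corner e z a : e * e = e -> phi a (e * z) = phi (e * a * e) z.
  move=> he.
  have -> : e * z = e * z * e + e * z * (1 - e) by ncring.
  rewrite (jzpDr hphi).
  have off b : phi b (e * z * (1 - e)) = 0.
    rewrite -[X in phi b X](addKr e) addrC (jzpDr hphi) (jzpNr hphi).
    by rewrite !(jzp_idem hphi h1) ?subr0 //; apply: idem_shift_ur.
  have off' b : phi b ((1 - e) * z * e) = 0.
    rewrite -[X in phi b X](addKr e) addrC (jzpDr hphi) (jzpNr hphi).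
    by rewrite !(jzp_idem hphi h1) ?subr0 //; apply: idem_shift_dl.
  rewrite off addr0.
  have -> : phi (e * a * e) z = phi (e * a * e) (e * z * e).
    have {1}-> : z = e * z * e + e * z * (1 - e) + (1 - e) * z * e
                  + (1 - e) * z * (1 - e) by ncring.
    rewrite !(jzpDr hphi) off off' !addr0.
    by rewrite [X in _ + X](jzp_zero hphi) ?addr0 //; idem_ring he.
  have {1}-> : a = e * a * e + e * a * (1 - e) + (1 - e) * a * e
                  + (1 - e) * a * (1 - e) by ncring.
  rewrite !(jzpDl hphi).
  rewrite (_ : phi (e * a * (1 - e)) _ = 0); last first.
    apply: (off_corner e) => //; first exact: idem_shift_ur.
    by idem_ring he.
  rewrite (_ : phi ((1 - e) * a * e) _ = 0); last first.
    apply: (off_corner e) => //; first exact: idem_shift_dl.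
    by idem_ring he.
  by rewrite !addr0 [X in _ + X](jzp_zero hphi) ?addr0 //; idem_ring he.
move=> hx.
(* The induction is on the left factor: products of idempotents are peeled off
   one by one. *)
suff mul_closed z : (forall a, phi a z = 0) -> forall a, phi a (x * z) = 0.
  by move=> a; rewrite -[x]mulr1; apply: mul_closed.
move: x hx z; apply: idempotent_subalgebra_ind.
- by move=> z hz a; rewrite mul1r.
- move=> k x y hx hy z hz a; rewrite mulrDl -scalerAl (jzp_linr hphi).
  by rewrite hx // hy // scaler0 addr0.
- by move=> x y hx hy z hz a; rewrite -mulrA; apply/hx/hy.
- by move=> e he z hz a; rewrite corner.
Qed.

Lemma jzp_idemsub_r phi (hphi : jordan_zero_preserving phi) x a :
  idempotent_subalgebra x -> phi a x + phi a x = phi (jordan_prod a x) 1.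
Proof.
move=> hx; apply/subr0_eq.
exact: (normalized_jzp (normalize_jzp hphi) (normalize1 hphi) hx a).
Qed.

Lemma jzp_idemsub_l phi (hphi : jordan_zero_preserving phi) x a :
  idempotent_subalgebra x -> phi x a + phi x a = phi 1 (jordan_prod x a).
Proof.
move=> hx; rewrite (_ : jordan_prod x a = jordan_prod a x); last exact: addrC.
exact: (jzp_idemsub_r (jzp_swap hphi) a hx).
Qed.

End JordanZeroProducts.

(** * The defect of the Jordan derivation rule *)

Section JordanDefect.
Variables (F : fieldType) (A : algType F) (M : bimodType A).
Hypothesis two_neq0 : (2%:R : F) != 0.
Hypothesis hunital : unital_bimodule M.
Local Notation FA := (@idempotent_subalgebra F A).
Implicit Types (D : {linear A -> M}) (a b x e : A) (m : M).

Lemma linear_lact m : linear (fun a : A => a *:> m).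
Proof. by move=> k x y; rewrite lactDl lactZl. Qed.

Lemma linear_ract m : linear (fun a : A => m <:* a).
Proof. by move=> k x y; rewrite ractDr ractZr. Qed.

Definition jordan_defect D a b : M :=
  D (jordan_prod a b) - (jordan_rprod (D a) b + jordan_lprod a (D b)).

Lemma jordan_defect_linl D b : linear (jordan_defect D ^~ b).
Proof.
apply: linear_sub; first by move=> k x y; rewrite linear_jordan_prodl linearP.
apply: linear_add; last first.
  by apply: linear_add; [apply: linear_lact | apply: linear_ract].
by apply: linear_add => k x y;
  rewrite linearP ?(ractDl, ractZl, lactDr, lactZr).
Qed.

Lemma jordan_defectC D a b : jordan_defect D a b = jordan_defect D b a.
Proof.
rewrite /jordan_defect (_ : jordan_prod a b = jordan_prod b a);
  last exact: addrC.
by congr (_ - _); bimod.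
Qed.

Lemma jordan_defectDl D a b x :
  jordan_defect D (a + b) x = jordan_defect D a x + jordan_defect D b x.
Proof. by have := jordan_defect_linl D x 1 a b; rewrite !scale1r. Qed.

Lemma jordan_defectDr D a b x :
  jordan_defect D x (a + b) = jordan_defect D x a + jordan_defect D x b.
Proof. by rewrite !(jordan_defectC D x) jordan_defectDl. Qed.

Definition jordan_on_idemsub D : Prop :=
  forall x, FA x -> forall a, jordan_defect D a x = 0.

Lemma inner_isLinear (m : M) : linear (fun a : A => m <:* a - a *:> m).
Proof. by apply: linear_sub; [apply: linear_ract | apply: linear_lact]. Qed.

Definition sub_inner D m : A -> M := fun a => D a - (m <:* a - a *:> m).

HB.instance Definition _ D m := GRing.isLinear.Build F A M *:%R
  (sub_inner D m) (linear_sub (linearP D) (inner_isLinear m)).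

Lemma sub_inner_defect D m a b :
  jordan_defect (sub_inner D m) a b = jordan_defect D a b.
Proof.
by rewrite /jordan_defect /= /sub_inner; bimod.
Qed.

(** The rule at [(e, e)] makes [D e] off-diagonal, so that [D e] is the double
    commutator of itself with [e]; hence the choice of [m]. *)
Lemma sub_inner_idem D e : e * e = e -> jordan_defect D e e = 0 ->
  exists m, sub_inner D m e = 0.
Proof.
move=> he h0; exists (D e <:* e - e *:> D e); rewrite /sub_inner.
have hs : D e = D e <:* e + e *:> D e.
  apply: (addrr_inj two_neq0); move: h0; rewrite /jordan_defect => /subr0_eq.
  rewrite {1}/jordan_prod he linearD => ->; bimod.
have hese : e *:> D e <:* e = 0.
  have := congr1 (fun m => e *:> m <:* e) hs => E.
  by apply: (eq_from_eq (esym E)); idem_bimod he.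
apply: (eq_from_eq hs).
by apply: (eq_from_eq (congr1 (fun m => m + m) hese)); idem_bimod he.
Qed.

Section KilledIdempotent.
Variables (D : {linear A -> M}).
Hypothesis hD : jordan_on_idemsub D.

Lemma killed_compl e : D e = 0 -> D (1 - e) = 0.
Proof.
move=> De; rewrite linearB De subr0; apply: (addrr_eq0 two_neq0).
have h1 := hD (@idemsub1 F A) 1.
apply: (eq_from_eq (esym h1)).
rewrite /jordan_defect /jordan_prod mulr1 (linearD D).
bimod.
Qed.

(** Because [2 (e a e) = (a o e) o e - a o e], and the rule computes [D] of both
    terms on the right. *)
Lemma killed_corner e a : e * e = e -> D e = 0 ->
  D (e * a * e) = e *:> D a <:* e.
Proof.
move=> he De; apply: (addrr_inj two_neq0).
have rule b : D (jordan_prod b e) = jordan_rprod (D b) e.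
  have /subr0_eq -> := hD (idemsub_idem he) b.
  by rewrite De; bimod.
have hc : jordan_prod (jordan_prod a e) e - jordan_prod a e
   = e * a * e + e * a * e by idem_ring he.
rewrite -(linearD D) -hc (linearB D) !rule.
by idem_bimod he.
Qed.

Lemma defect_corners e a b : e * e = e -> D e = 0 ->
  jordan_defect D (e * a * e) ((1 - e) * b * (1 - e)) = 0.
Proof.
move=> he De; rewrite /jordan_defect.
rewrite !killed_corner ?idem_compl //; last exact: killed_compl.
rewrite (_ : jordan_prod _ _ = 0) ?linear0; last by idem_ring he.
by idem_bimod he.
Qed.

Lemma defect_corner_compl e a b : e * e = e -> D e = 0 ->
  let w := jordan_defect D (e * a * e) (e * b * e) in
  w <:* (1 - e) = 0.
Proof.
move=> he De w; rewrite /w /jordan_defect.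
rewrite (_ : jordan_prod _ _ = e * jordan_prod (e * a * e) (e * b * e) * e);
  last by idem_ring he.
rewrite !killed_corner //.
by idem_bimod he.
Qed.

Lemma defect_corner e a b : e * e = e -> D e = 0 ->
  jordan_defect D (e * a * e) b = jordan_defect D (e * a * e) (e * b * e).
Proof.
move=> he De.
have {1}-> : b = e * b * e + e * b * (1 - e) + (1 - e) * b * e
                + (1 - e) * b * (1 - e) by ncring.
rewrite !jordan_defectDr defect_corners // !addr0.
by rewrite (hD (idemsub_offdiag_ur b he)) (hD (idemsub_offdiag_dl b he)) !addr0.
Qed.

End KilledIdempotent.

(** Subtracting an inner derivation reduces to [D e = 0].  Then off-diagonal
    components have no defect, and both sides reduce to the defect of [e a e]. *)
Lemma defect_idem D (hD : jordan_on_idemsub D) e a b : e * e = e ->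
  jordan_defect D (e * a) b = jordan_defect D a b <:* e /\
  jordan_defect D (a * e) b = jordan_defect D a b <:* e.
Proof.
move=> he.
have [m De] : exists m, sub_inner D m e = 0.
  by apply: sub_inner_idem => //; apply: hD; apply: idemsub_idem.
pose D0 : {linear A -> M} := sub_inner D m.
have hD0 : jordan_on_idemsub D0.
  by move=> x hx c; rewrite sub_inner_defect; apply: hD.
rewrite -!(sub_inner_defect D m) -/D0.
have {}De : D0 e = 0 by [].
move: D0 hD0 De => D' hD' De.
have off_ur c : jordan_defect D' (e * c * (1 - e)) b = 0.
  by rewrite jordan_defectC hD' //; apply: idemsub_offdiag_ur.
have off_dl c : jordan_defect D' ((1 - e) * c * e) b = 0.
  by rewrite jordan_defectC hD' //; apply: idemsub_offdiag_dl.
have hl : jordan_defect D' (e * a) b = jordan_defect D' (e * a * e) b.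
  have -> : e * a = e * a * e + e * a * (1 - e) by ncring.
  by rewrite jordan_defectDl off_ur addr0; congr jordan_defect; idem_ring he.
have hr : jordan_defect D' (a * e) b = jordan_defect D' (e * a * e) b.
  have -> : a * e = e * a * e + (1 - e) * a * e by ncring.
  by rewrite jordan_defectDl off_dl addr0; congr jordan_defect; idem_ring he.
suff -> : jordan_defect D' a b <:* e = jordan_defect D' (e * a * e) b by [].
have {1}-> : a = e * a * e + e * a * (1 - e) + (1 - e) * a * e
                + (1 - e) * a * (1 - e) by ncring.
rewrite !jordan_defectDl off_ur off_dl !addr0 ractDl.
have he' := idem_compl he.
have De1 := killed_compl hD' De.
have h1 : jordan_defect D' (e * a * e) b <:* (1 - e) = 0.
  rewrite defect_corner //; exact: defect_corner_compl.
have h2 : jordan_defect D' ((1 - e) * a * (1 - e)) b <:* e = 0.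
  rewrite (_ : e = 1 - (1 - e)); last by ncring.
  rewrite (_ : (1 - (1 - (1 - e))) = 1 - e); last by ncring.
  rewrite (defect_corner hD') //; exact: (defect_corner_compl hD').
rewrite h2 addr0.
by apply: (eq_from_eq (esym h1)); bimod.
Qed.

(** Both sides are needed for products: computing the defect of [x a y] in two
    ways shows that the defect does not see the order of [x] and [y]. *)
Lemma defect_idemsub D (hD : jordan_on_idemsub D) x : FA x -> forall a b,
  jordan_defect D (x * a) b = jordan_defect D a b <:* x /\
  jordan_defect D (a * x) b = jordan_defect D a b <:* x.
Proof.
move: x; apply: idempotent_subalgebra_ind.
- by move=> a b; rewrite mul1r mulr1; split; bimod.
- move=> k x y hx hy a b.
  rewrite mulrDl mulrDr -scalerAl -scalerAr !(jordan_defect_linl D b).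
  by rewrite (hx a b).1 (hy a b).1 (hx a b).2 (hy a b).2 ractDr ractZr.
- move=> x y hx hy a b.
  have swap : jordan_defect D a b <:* (x * y) = jordan_defect D a b <:* (y * x).
    rewrite !ractM -(hx a b).1 -(hy _ b).2 -(hy a b).2 -(hx _ b).1.
    by rewrite mulrA.
  split; first by rewrite -mulrA (hx _ b).1 (hy a b).1 swap ractM.
  by rewrite mulrA (hy _ b).2 (hx a b).2 ractM.
- by move=> e he a b; apply: defect_idem.
Qed.

End JordanDefect.

(** * Consequences of property M *)

Section DetectingIdeal.
Variables (F : fieldType) (A : algType F) (M : bimodType A).
Hypothesis two_neq0 : (2%:R : F) != 0.
Hypothesis hunital : unital_bimodule M.
Local Notation FA := (@idempotent_subalgebra F A).

Variable J : set A.
Hypothesis J_lmul : forall a x, J x -> J (a * x).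
Hypothesis J_rmul : forall a x, J x -> J (x * a).
Hypothesis J_FA : forall x, J x -> FA x.
Hypothesis J_detects :
  forall m : M, (forall x, J x -> x *:> m <:* x = 0) -> m = 0.

(** Multiplying [x m + m x = 0] by [x] on either side and subtracting the same
    relation for [x * x] leaves [2 x m x = 0]. *)
Lemma J_jordan_detects (m : M) :
  (forall x, J x -> jordan_lprod x m = 0) -> m = 0.
Proof.
move=> h; apply: J_detects => x Jx; apply: (addrr_eq0 two_neq0).
have E := h x Jx; have E2 := h (x * x) (J_lmul x Jx).
have C := eq_sub
  (eq_add (congr1 (lact x) E) (congr1 (ract^~ x) E)) E2.
by apply: (eq_from_eq C); rewrite lact0 ract0; bimod.
Qed.

(** For [x] in [J] the defect of [(a, a)] times [x] is the defect of [(x a, a)],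
    and [x a] lies in [J]. *)
Lemma jordan_derivation_from_idemsub (D : {linear A -> M}) :
  jordan_on_idemsub D -> jordan_derivation D.
Proof.
move=> hD a; apply: (addrr_inj two_neq0).
have defect0 : jordan_defect D a a = 0.
  apply: J_detects => x Jx.
  rewrite lract -(defect_idemsub two_neq0 hunital hD (J_FA Jx) a a).1.
  have hxa : FA (x * a) by apply: J_FA; apply: J_rmul.
  by rewrite (jordan_defectC hunital) (hD _ hxa) lact0.
apply: (eq_from_eq defect0); rewrite /jordan_defect (linearD D).
bimod.
Qed.

(** * The equation on Jordan-zero pairs *)

Section JordanZeroEquation.
Variables delta sigma : {linear A -> M}.
Hypothesis hds : forall a b, jordan_prod a b = 0 ->
  jordan_rprod (delta a) b + jordan_lprod a (sigma b) = 0.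
Local Notation c := (delta 1).
Local Notation d := (sigma 1).
Local Notation comm m a := (m <:* a - a *:> m).

Let phi a b : M := jordan_rprod (delta a) b + jordan_lprod a (sigma b).

Lemma phi_jzp : jordan_zero_preserving phi.
Proof.
split; last exact: hds.
- move=> b; apply: linear_add; last first.
    by apply: linear_add; [apply: linear_lact | apply: linear_ract].
  by apply: linear_add => k x y;
    rewrite linearP ?(ractDl, ractZl, lactDr, lactZr).
- move=> a; apply: linear_add.
    by apply: linear_add; [apply: linear_ract | apply: linear_lact].
  by apply: linear_add => k x y;
    rewrite linearP ?(ractDl, ractZl, lactDr, lactZr).
Qed.

Lemma delta_idemsub x a : FA x ->
  phi a x + phi a x = delta (jordan_prod a x) + delta (jordan_prod a x)
                      + jordan_lprod (jordan_prod a x) d.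
Proof.
move=> hx; rewrite (jzp_idemsub_r two_neq0 phi_jzp a hx) /phi.
by move: (jordan_prod a x) => y; bimod.
Qed.

Lemma sigma_idemsub x a : FA x ->
  phi x a + phi x a = jordan_rprod c (jordan_prod a x)
                      + sigma (jordan_prod a x) + sigma (jordan_prod a x).
Proof.
move=> hx; rewrite (jzp_idemsub_l two_neq0 phi_jzp a hx) /phi.
rewrite (_ : jordan_prod x a = jordan_prod a x); last exact: addrC.
by move: (jordan_prod a x) => y; bimod.
Qed.

Lemma delta_sigma_idemsub x : FA x ->
  jordan_rprod c x + sigma x + sigma x = delta x + delta x + jordan_rprod d x.
Proof.
move=> hx; apply: (addrr_inj two_neq0).
have := delta_idemsub 1 hx.
rewrite /phi /jordan_prod mul1r mulr1 /= (linearD delta).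
by move=> E; apply: (eq_from_eq E); bimod.
Qed.

(** The case of an idempotent [e] comes from the off-diagonal Peirce components
    of the equation at [(e, e)]. *)
Lemma sum_comm_idemsub x : FA x -> comm (c + d) x = 0.
Proof.
move: x; apply: idempotent_subalgebra_ind.
- by bimod.
- move=> k x y hx hy.
  by rewrite (linear_sub (linear_ract _) (linear_lact _)) hx hy scaler0 addr0.
- move=> x y hx hy.
  have C := eq_add (congr1 (ract^~ y) hx) (congr1 (lact x) hy).
  by apply: (eq_from_eq C); rewrite lact0 ract0; bimod.
move=> e he.
(* The identity for [phi e e], in which [sigma e] is replaced by means of
   [delta_sigma_idemsub]; its off-diagonal components involve only [c + d]. *)
have E1 : jordan_rprod (delta e) e + jordan_lprod e (sigma e)
        = delta e + delta e + jordan_lprod e d.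
  apply: (addrr_inj two_neq0); have := delta_idemsub e (idemsub_idem he).
  rewrite /phi /jordan_prod he /= (linearD delta) => E.
  by apply: (eq_from_eq E); bimod.
have E2 := delta_sigma_idemsub (idemsub_idem he).
have E : jordan_rprod (delta e) e + jordan_rprod (delta e) e
   + jordan_lprod e (delta e + delta e + jordan_rprod d e - jordan_rprod c e)
   = delta e + delta e + jordan_lprod e d
     + (delta e + delta e + jordan_lprod e d).
  rewrite -E1 -E2; bimod.
have ur : e *:> (c + d) <:* (1 - e) = 0.
  apply: (eq_from_eq (esym (congr1 (fun m => e *:> m <:* (1 - e)) E))).
  by idem_bimod he.
have dl : (1 - e) *:> (c + d) <:* e = 0.
  apply: (eq_from_eq (esym (congr1 (fun m => (1 - e) *:> m <:* e) E))).
  by idem_bimod he.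
by apply: (eq_from_eq (eq_sub dl ur)); bimod.
Qed.

(** For [x] in [J] both [x] and [x a] are in the generated subalgebra, so
    [x (m a - a m) x = 0] with [m = c + d]. *)
Lemma sum_comm a : comm (c + d) a = 0.
Proof.
apply: J_detects => x Jx.
have hx := sum_comm_idemsub (J_FA Jx).
have hxa := sum_comm_idemsub (J_FA (J_rmul a Jx)).
have C := eq_sub (congr1 (ract^~ x) hxa)
  (congr1 (ract^~ (a * x)) hx).
by apply: (eq_from_eq C); rewrite !ract0; bimod.
Qed.

(** Compares [phi x y] with [phi y x], both determined by [x o y]. *)
Lemma diff_comm_idemsub x y : FA x -> FA y -> comm (c - d) (x * y - y * x) = 0.
Proof.
move=> hx hy.
have Exy : phi x y = phi y x.
  apply: (addrr_inj two_neq0); rewrite !delta_idemsub //.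
  by rewrite (_ : jordan_prod x y = jordan_prod y x) //; exact: addrC.
have C := eq_add
  (eq_sub (eq_add Exy Exy) (congr1 (jordan_lprod x) (delta_sigma_idemsub hy)))
  (congr1 (jordan_lprod y) (delta_sigma_idemsub hx)).
by apply: (eq_from_eq C); rewrite /phi; bimod.
Qed.

(** For an idempotent [e], the commutator of [e] with [a] is its commutator with
    the off-diagonal part of [a], which lies in the generated subalgebra; products
    follow from [[x y, a] = [x, y a] + [y, a x]]. *)
Lemma diff_comm x a : FA x -> comm (c - d) (x * a - a * x) = 0.
Proof.
move=> hx; move: x hx a; apply: idempotent_subalgebra_ind.
- by move=> a; bimod.
- move=> k x y hx hy a; rewrite mulrDl mulrDr -scalerAl -scalerAr opprD addrACA.
  rewrite -scalerBr (linear_sub (linear_ract _) (linear_lact _)) hx hy.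
  by rewrite scaler0 addr0.
- move=> x y hx hy a.
  have C := eq_add (hx (y * a)) (hy (a * x)).
  by apply: (eq_from_eq C); bimod.
move=> e he a.
pose w := e * a * (1 - e) + (1 - e) * a * e.
have hw : FA w.
  by apply: idemsubD; [apply: idemsub_offdiag_ur | apply: idemsub_offdiag_dl].
rewrite (_ : e * a - a * e = e * w - w * e); last by rewrite /w; idem_ring he.
by apply: diff_comm_idemsub => //; apply: idemsub_idem.
Qed.

(** With [k = c - d] and [z] the difference of the two sides, the identities for
    [phi a x], [phi x a] and the centrality of [c + d] give
    [2 (x o z) = a o (k o x) - x o (k o a)], which is the commutator of [k] with
    [x a - a x]. *)
Lemma delta_sub_sigma a : delta a - sigma a = c <:* a - a *:> d.
Proof.
apply/subr0_eq/J_jordan_detects => x Jx; apply: (addrr_eq0 two_neq0).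
have hx := J_FA Jx.
have hy : FA (jordan_prod a x).
  by apply: idemsubD; apply: J_FA; [apply: J_lmul | apply: J_rmul].
have C0 := eq_sub (eq_sub (delta_idemsub a hx) (sigma_idemsub a hx))
  (delta_sigma_idemsub hy).
have C := eq_sub
  (eq_add (eq_sub C0 (congr1 (jordan_lprod a) (delta_sigma_idemsub hx)))
    (diff_comm a hx))
  (congr1 (jordan_lprod x) (sum_comm a)).
apply: (eq_from_eq C); rewrite /phi; move: (jordan_prod a x) => y.
by bimod.
Qed.

Definition jordan_part : A -> M := fun a => delta a - c <:* a.

HB.instance Definition _ := GRing.isLinear.Build F A M *:%R
  jordan_part (linear_sub (linearP delta) (linear_ract c)).

Lemma jordan_part_derivation : jordan_derivation jordan_part.
Proof.
apply: jordan_derivation_from_idemsub => x hx a.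
(* Twice the defect reduces to the commutator of [d] with [x a - a x], and
   [2 d = (c + d) - (c - d)]; this accounts for the factor 4. *)
do 2 apply: (addrr_eq0 two_neq0).
have Q := eq_add (congr1 (jordan_lprod a) (delta_sub_sigma x))
  (congr1 (ract^~ a) (sum_comm x)).
have Q2 := eq_add Q Q.
have C := eq_sub (eq_sub (sum_comm (x * a - a * x)) (diff_comm a hx))
  (eq_add (eq_add (delta_idemsub a hx) (delta_idemsub a hx)) (eq_add Q2 Q2)).
apply: (eq_from_eq C); rewrite /jordan_defect /= /jordan_part /phi.
by bimod.
Qed.

End JordanZeroEquation.
End DetectingIdeal.

(** * The involution *)

Lemma real_or_complex_spec (R : realType) (F : fieldType) (conj : F -> F) :
  real_or_complex R conj -> (2%:R : F) != 0 /\ involutive conj.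
Proof.
by case; split; rewrite ?Num.Theory.pnatr_eq0 // => z; rewrite /= conjcK.
Qed.

Section StarConjugate.
Variables (F : fieldType) (conj : F -> F) (A : starAlgType conj).
Variable M : starBimodType A.
Hypothesis conjK : involutive conj.

Lemma star1 : star (1 : A) = 1.
Proof. by rewrite -[LHS]mul1r -{1}[1]starK -starM mul1r starK. Qed.

Lemma mstarB (m n : M) : mstar (m - n) = mstar m - mstar n.
Proof. by rewrite -[in RHS](subrK n m) [in RHS]mstarD addrK. Qed.

(** The involutivity of [conj], which makes this map linear, is an index so that
    the linear structure can be found by unification. *)
Definition star_conjugate of involutive conj := fun (f : {linear A -> M}) a =>
  mstar (f (star a)).

Lemma star_conjugate_linear f : linear (star_conjugate conjK f).
Proof.
move=> k x y; rewrite /star_conjugate starD starZ linearP mstarD mstarZ.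
by rewrite conjK.
Qed.

HB.instance Definition _ f := GRing.isLinear.Build F A M *:%R
  (star_conjugate conjK f) (star_conjugate_linear f).

Lemma star_conjugate_jordan (D : {linear A -> M}) :
  jordan_derivation D -> jordan_derivation (star_conjugate conjK D).
Proof.
move=> hD a; rewrite /= /star_conjugate starM hD mstarD.
by rewrite mstar_ract mstar_lact starK addrC.
Qed.

End StarConjugate.

(** * Existence of the Jordan derivations *)

Theorem corollary5p6 (R : realType) (F : fieldType) (conj : F -> F)
    (hF : real_or_complex R conj)
    (A : starAlgType conj) (M : starBimodType A)
    (hunital : unital_bimodule M) (hM : property_M M)
    (delta tau : {linear A -> M})
    (hdt : forall a b : A, jordan_prod a (star b) = 0 ->
       jordan_rprod (delta a) (star b) + jordan_lprod a (mstar (tau b)) = 0) :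
  exists Delta Gamma : {linear A -> M},
    [/\ jordan_derivation Delta,
        jordan_derivation Gamma
      & forall a : A,
          [/\ delta a = Delta a + delta 1 <:* a,
              tau a = Gamma a + tau 1 <:* a
            & Delta (star a) = mstar (Gamma a)]].
Proof.
have [two_neq0 conjK] := real_or_complex_spec hF.
have [J [[_ J_ideal] J_FA J_det]] := hM.
have J_detects (m : M) : (forall x, J x -> x *:> m <:* x = 0) -> m = 0.
  move=> hm.
  have : [set m : M | forall x, J x -> x *:> m <:* x = 0]%classic m by [].
  by rewrite J_det.
have J_lmul a x (Jx : J x) := (J_ideal a x Jx).1.
have J_rmul a x (Jx : J x) := (J_ideal a x Jx).2.
pose sigma : {linear A -> M} := star_conjugate conjK tau.
have hds a b : jordan_prod a b = 0 ->
    jordan_rprod (delta a) b + jordan_lprod a (sigma b) = 0.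
  by rewrite -{1 2}[b]starK; apply: hdt.
pose Delta : {linear A -> M} := jordan_part delta.
have hDelta : jordan_derivation Delta.
  exact: (jordan_part_derivation two_neq0 hunital J_lmul J_rmul J_FA J_detects
    hds).
pose Gamma : {linear A -> M} := star_conjugate conjK Delta.
exists Delta, Gamma; split => //; first exact: star_conjugate_jordan.
move=> a; split; last by rewrite /= /star_conjugate mstarK.
  by rewrite /= /jordan_part subrK.
have E := delta_sub_sigma two_neq0 hunital J_lmul J_rmul J_FA J_detects hds
  (star a).
have {E} : Delta (star a) = sigma (star a) - star a *:> sigma 1.
  rewrite /= /jordan_part; apply: (eq_from_eq E); bimod.
rewrite [sigma _]/= [sigma _]/= /star_conjugate starK star1.
rewrite [Gamma a]/= /star_conjugate => ->.
by rewrite mstarB mstar_lact starK !mstarK subrK.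
Qed.
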